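(* No space in class $\mathcal R$ contains a cutting P-point.
   Context: All spaces are completely regular Hausdorff; maps are continuous. A retraction is a map $f\colon X\to Y$ having a right inverse, i.e. a continuous $g\colon Y\to X$ with $fg=\mathrm{id}_Y$. An inverse sequence is an inverse system $\mathbb S=\langle X_\xi,p_\xi^\eta,\lambda\rangle$ indexed by an ordinal $\lambda$. It is continuous if for every limit ordinal $\delta<\lambda$ the space $X_\delta$ together with the maps $p_\xi^\delta$ ($\xi<\delta$) is the inverse limit of $\mathbb S\restriction\delta$. $\mathcal R$ is the smallest class of compact spaces which contains all metrizable compact spaces and is closed under limits of continuous inverse sequences whose bonding maps are retractions. A point $p$ of a space $Y$ is a P-point in $Y$ if $p$ is not isolated in $Y$ and for every sequence $\{u_n\}_{n\in\omega}$ of neighborhoods of $p$ we have $p\in\operatorname{int}(\bigcap_{n\in\omega}u_n)$. A point $p\in X$ is a cutting P-point in $X$ if there exist closed sets $A,B\subseteq X$ with $A\cup B=X$, $A\cap B=\{p\}$ and such that $p$ is a P-point both in the subspace $A$ and in the subspace $B$. *)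

(* Defs.v *)
From HB Require Import structures.
From mathcomp Require Import all_boot all_order all_algebra.
From mathcomp Require Import all_classical all_reals all_analysis.

Set Implicit Arguments.
Unset Strict Implicit.
Unset Printing Implicit Defensive.

Import Order.TTheory.

Local Open Scope order_scope.
Local Open Scope classical_set_scope.

Definition retraction (X Y : topologicalType) (f : X -> Y) : Prop :=
  continuous f /\ exists g : Y -> X, continuous g /\ cancel g f.

Definition homeomorphism (X Y : topologicalType) (f : X -> Y) : Prop :=
  continuous f /\
  exists g : Y -> X, [/\ continuous g, cancel f g & cancel g f].

Definition homeomorphic (X Y : topologicalType) : Prop :=
  exists f : X -> Y, homeomorphism f.

Definition metrizable (R : realType) (X : topologicalType) : Prop :=
  exists M : metricType R, homeomorphic X M.

(* An ordinal is rendered as a well-founded total order I; well-foundedness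
   is only required in classR, where these systems are used.
   [bond S ij] is the map $p_i^j$ from X_j to X_i, for [ij : i <= j]. *)
Record inverse_sequence (d : Order.disp_t) (I : orderType d) :=
    InverseSequence {
  space :> I -> topologicalType ;
  bond : forall i j : I, i <= j -> space j -> space i ;
  bond_continuous : forall (i j : I) (ij : i <= j), continuous (bond ij) ;
  bond_id : forall (i : I) (ii : i <= i) (x : space i), bond ii x = x ;
  bond_comp : forall (i j k : I) (ij : i <= j) (jk : j <= k) (ik : i <= k)
    (x : space k), bond ij (bond jk x) = bond ik x
}.

Arguments bond {d I} S {i j} : rename.

(* The inverse limit of the restriction of S to D: the set of threads in the
   product of the spaces indexed by D. Used as a type, it carries the topology
   induced by the product topology. *)
Definition inverse_limit (d : Order.disp_t) (I : orderType d)
    (S : inverse_sequence I) (D : set I) :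
    set (prod_topology (fun i : D => S (set_val i))) :=
  [set x | forall (i j : D) (ij : set_val i <= set_val j),
     bond S ij (x j) = x i].

Arguments inverse_limit {d I} S D : rename.

Definition limit_index (d : Order.disp_t) (I : orderType d) (k : I) : Prop :=
  (exists i : I, i < k) /\ (forall i : I, i < k -> exists2 j : I, i < j & j < k).

Definition below (d : Order.disp_t) (I : orderType d) (k : I) : set I :=
  [set i | i < k].

Definition continuous_sequence (d : Order.disp_t) (I : orderType d)
    (S : inverse_sequence I) : Prop :=
  forall k : I, limit_index k ->
    exists h : S k -> inverse_limit S (below k),
      homeomorphism h /\
      forall (x : S k) (i : below k),
        set_val (h x) i = bond S (ltW (set_valP i)) x.

(* Limits are determined up to homeomorphism only. No separation or compactness
   requirement is needed on the limits: compact metrizable spaces are compact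
   Hausdorff, and limits of inverse sequences of compact Hausdorff spaces
   are compact Hausdorff, hence completely regular. *)
Inductive classR (R : realType) : topologicalType -> Prop :=
| classR_metrizable (X : topologicalType) :
    compact [set: X] -> metrizable R X -> classR R X
| classR_limit (d : Order.disp_t) (I : orderType d) (S : inverse_sequence I)
    (X : topologicalType) :
    well_founded (fun i j : I => i < j) ->
    (forall i : I, classR R (S i)) ->
    continuous_sequence S ->
    (forall (i j : I) (ij : i <= j), retraction (bond S ij)) ->
    homeomorphic X (inverse_limit S [set: I]) ->
    classR R X.

Definition P_point (Y : topologicalType) (p : Y) : Prop :=
  ~ isolated [set: Y] p /\
  forall u : nat -> set Y, (forall n, nbhs p (u n)) ->
    interior (\bigcap_n u n) p.

(* [subspace A] adds the points outside A as isolated points, which does not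
   affect the neighborhoods in A of a point p of A. *)
Definition cutting_P_point (X : topologicalType) (p : X) : Prop :=
  exists A B : set X,
    [/\ closed A, closed B, A `|` B = [set: X] & A `&` B = [set p]] /\
    @P_point (subspace A) p /\ @P_point (subspace B) p.

(* Main.v *)
Require Import Defs.
From HB Require Import structures.
From mathcomp Require Import all_boot all_order all_algebra.
From mathcomp Require Import all_classical all_reals all_analysis.

(* A continuous inverse sequence of retractions with limit X yields coherent
   sections of the projections, hence retractions r_i : X -> X such that
   r_i r_j = r_j r_i = r_i for i <= j, r_i x tends to x, and r_k x is the limit of
   the r_i x, i < k, at limit indices k. Let A, B witness that p is a cutting
   P-point of X. If, for cofinally many i, r_i maps a neighborhood of p into B,
   choose inductively such indices i_n and points x_n of A \ {p} close enough to p
   that r_(i_n) x_m is in B for n <= m, and x_n is fixed by r_(i_(n+1)). As p is a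
   P-point of A, the x_n cluster at some x in A \ {p}. Then r_(i_n) x is in the
   open set A \ {p} for some n, and so is r_(i_n) x_m for some m >= n, a
   contradiction. Exchanging A and B, there is an i such that r_i maps no
   neighborhood of p into A or into B; then r_i p = p, and X_i already contains a
   cutting P-point. Conclude by induction on the class R, since compact metrizable
   spaces have no P-points. *)

Set Implicit Arguments.
Unset Strict Implicit.
Unset Printing Implicit Defensive.

Import Order.TTheory GRing.Theory Num.Theory.

Local Open Scope order_scope.
Local Open Scope classical_set_scope.

(** * Choice functions, and convergence in initial and product topologies *)

Lemma choice_dep (T : Type) (U : T -> Type) (P : forall x, U x -> Prop) :
  (forall x, exists y, P x y) -> exists f : forall x, U x, forall x, P x (f x).
Proof.
by move=> ex; exists (fun x => sval (cid (ex x))) => x; exact: (svalP (cid (ex x))).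
Qed.

Lemma initial_topology_cvg (S : choiceType) (T : topologicalType) (f : S -> T)
    (F : set_system S) (s : S) :
  Filter F -> f x @[x --> F] --> f s -> F --> (s : initial_topology f).
Proof.
move=> FF fF U [_ [[V Vo <-] Vs VU]]; rewrite nbhs_filterE.
by apply: filterS VU _; apply: fF; exact: open_nbhs_nbhs.
Qed.

Lemma prod_topology_cvg (I : Type) (T : I -> topologicalType)
    (F : set_system (prod_topology T)) (x : prod_topology T) :
  Filter F -> (forall i, y i @[y --> F] --> x i) -> F --> x.
Proof.
move=> FF Fx; apply/cvg_sup => i.
exact: (@initial_topology_cvg _ _ (fun f : forall i, T i => f i)).
Qed.

Lemma prod_topology_proj_continuous (I : Type) (T : I -> topologicalType) (i : I) :
  continuous (fun x : prod_topology T => x i).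
Proof.
move=> x; have /cvg_sup/(_ i) : x --> x by exact: cvg_id.
move=> xx; apply: cvg_trans (@initial_continuous _ _
  (fun f : forall i, T i => f i) x).
exact: cvg_app.
Qed.

(* A presentation of the limit of S restricted to D that does not mention the
   type of threads. *)
Record limit_cone (d : Order.disp_t) (I : orderType d) (S : inverse_sequence I)
    (D : set I) (X : topologicalType) (pi : forall i : D, X -> S (set_val i)) :
    Prop := LimitCone {
  cone_continuous : forall i, continuous (pi i) ;
  cone_bond : forall (i j : D) (ij : set_val i <= set_val j) (x : X),
    bond S ij (pi j x) = pi i x ;
  cone_thread : forall y : (forall i : D, S (set_val i)),
    (forall (i j : D) (ij : set_val i <= set_val j), bond S ij (y j) = y i) ->
    exists x, forall i, pi i x = y i ;
  cone_inj : forall x y, (forall i, pi i x = pi i y) -> x = y ;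
  cone_cvg : forall (F : set_system X) (x : X), Filter F ->
    (forall i, pi i y @[y --> F] --> pi i x) -> F --> x }.

Arguments cone_continuous {d I S D X pi} c i x : rename.

(** * Separation, compactness and neighborhoods in inverse limits *)

Section inverse_limits.
Context {d : Order.disp_t} {I : orderType d} (S : inverse_sequence I).

Lemma inverse_limit_proj_continuous (D : set I) (i : D) :
  continuous (fun x : inverse_limit S D => set_val x i).
Proof.
move=> x; apply: (@continuous_comp _ _ _ set_val
  (fun y : prod_topology (fun i : D => S (set_val i)) => y i)).
  exact: initial_continuous.
exact: prod_topology_proj_continuous.
Qed.

Lemma inverse_limit_cvg (D : set I) (F : set_system (inverse_limit S D))
    (x : inverse_limit S D) :
  Filter F -> (forall i, set_val y i @[y --> F] --> set_val x i) -> F --> x.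
Proof.
move=> FF Fx; apply: initial_topology_cvg.
by apply: prod_topology_cvg => i; exact: Fx.
Qed.

Lemma homeomorphism_limit_cone (D : set I) (X : topologicalType)
    (h : X -> inverse_limit S D) :
  homeomorphism h -> limit_cone (fun i x => set_val (h x) i).
Proof.
move=> [hc [g [gc hK gK]]]; split.
- move=> i x; apply: (@continuous_comp _ _ _ h (fun y => set_val y i)).
    exact: hc.
  exact: (@inverse_limit_proj_continuous D i).
- by move=> i j ij x; exact: (set_valP (h x)).
- move=> y yP; exists (g (SigSub (mem_set (yP : inverse_limit S D y)))) => i.
  by rewrite gK.
- move=> x y xy; rewrite -(hK x) -(hK y); congr g; apply: val_inj.
  exact: functional_extensionality_dep.
- move=> F x FF Fx.
  have hF : h y @[y --> F] --> h x by apply: inverse_limit_cvg.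
  have : g (h y) @[y --> F] --> g (h x) by apply: continuous_cvg => //; exact: gc.
  by under eq_fun do rewrite hK; rewrite hK.
Qed.

Lemma cone_continuous_to (D : set I) (X : topologicalType)
    (pi : forall i : D, X -> S (set_val i)) (Y : topologicalType) (f : Y -> X) :
  limit_cone pi -> (forall i, continuous (fun y => pi i (f y))) -> continuous f.
Proof. by move=> c fc y; apply: (cone_cvg c) => i; exact: fc. Qed.

Lemma cone_hausdorff (D : set I) (X : topologicalType)
    (pi : forall i : D, X -> S (set_val i)) :
  limit_cone pi -> (forall i, hausdorff_space (S i)) -> hausdorff_space X.
Proof.
move=> c Sh x y; rewrite cluster_cvgE => -[F PF [Fy Fx]]; apply: (cone_inj c) => i.
apply: (@cvg_unique _ (Sh (set_val i)) (pi i z @[z --> F])).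
- exact: (cvg_trans (cvg_app (pi i) Fx) (cone_continuous c i x)).
- exact: (cvg_trans (cvg_app (pi i) Fy) (cone_continuous c i y)).
Qed.

(** Each coordinate of an ultrafilter converges, and the limits form a thread because limits in
    Hausdorff spaces are unique. *)
Lemma cone_compact (D : set I) (X : topologicalType)
    (pi : forall i : D, X -> S (set_val i)) :
  limit_cone pi -> (forall i, hausdorff_space (S i)) ->
  (forall i, compact [set: S i]) -> compact [set: X].
Proof.
move=> c Sh Sc; rewrite compact_ultra => F UF _.
have Fcvg i : exists y : S (set_val i), pi i z @[z --> F] --> y.
  have [y [_ yF]] := Sc (set_val i) (pi i z @[z --> F]) _ filterT.
  (* An ultrafilter converges to its cluster points: a neighborhood outside it would have its
     complement in it. *)
  exists y => U Uy; rewrite nbhs_filterE /=.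
  have [//|FU] := in_ultra_setVsetC (pi i @^-1` U) UF.
  by have [z [/= nUz Uz]] := yF (~` U) U FU Uy.
have [y Fy] := choice_dep Fcvg.
have [x xy] : exists x, forall i, pi i x = y i.
  apply: (cone_thread c) => i j ij.
  have : bond S ij (pi j z) @[z --> F] --> bond S ij (y j).
    by apply: continuous_cvg => //; exact: bond_continuous.
  under eq_fun do rewrite (cone_bond c ij).
  by move/cvg_unique; apply => //; exact: Fy.
by exists x; split => //; apply: (cone_cvg c) => i; rewrite xy.
Qed.

(** Indices being linearly ordered, the fibres through [x] form a filter base; every projection is
    constant on some fibre, so this filter converges to [x]. *)
Lemma cone_nbhs (D : set I) (X : topologicalType)
    (pi : forall i : D, X -> S (set_val i)) (x : X) (W : set X) :
  limit_cone pi -> D !=set0 -> nbhs x W ->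
  exists i, forall y, pi i y = pi i x -> W y.
Proof.
move=> c [i0 Di0].
pose F : set_system X := filter_from setT (fun i => [set y | pi i y = pi i x]).
have FF : Filter F.
  apply: filter_from_filter; first by exists (SigSub (mem_set Di0)).
  move=> i j _ _.
  have [ij|/ltW ji] := leP (set_val i) (set_val j).
    by exists j => // y /= yx; rewrite -!(cone_bond c ij) yx.
  by exists i => // y /= yx; rewrite -!(cone_bond c ji) yx.
have Fx : F --> x.
  apply: (cone_cvg c) => i U /nbhs_singleton Ux.
  by exists i => // y /= ->.
by move=> /Fx [i _ iW]; exists i.
Qed.

End inverse_limits.

(** * Least elements, P-points of subspaces, cluster points of fixed points *)

Lemma well_founded_min (d : Order.disp_t) (I : orderType d) (P : set I) (i : I) :
  well_founded (fun i j : I => i < j) -> P i ->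
  exists2 k, P k & forall j, P j -> k <= j.
Proof.
move=> wf; elim/(well_founded_ind wf): i => i IH Pi.
have [[j [ji Pj]]|noj] := pselect (exists j, j < i /\ P j); first exact: (IH j).
exists i => // j Pj; rewrite leNgt; apply/negP => ji; apply: noj.
by exists j.
Qed.

(** Both conditions are expressed by neighborhoods in [X], so that later arguments avoid the
    subspace topology. *)
Lemma subspace_P_point (X : topologicalType) (A : set X) (p : X) : A p ->
  @P_point (subspace A) p <->
  (forall U, nbhs p U -> exists x, [/\ A x, U x & x <> p]) /\
  (forall u : nat -> set X, (forall n, nbhs p [set x | A x -> u n x]) ->
     nbhs p [set x | A x -> forall n, u n x]).
Proof.
move=> Ap; rewrite /P_point /interior /isolated.
have E : nbhs (p : subspace A) = within A (nbhs p) by rewrite nbhs_subspace_in.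
rewrite E; split=> -[iso uP]; split.
- move=> U Up; apply: contrapT => noU; apply: iso; split; first by rewrite inE.
  exists (A `&` U); first by rewrite /within /=; apply: filterS Up => x Ux Ax.
  rewrite setIT; apply/seteqP; split=> [x [Ax Ux]|x -> /=].
    by apply: contrapT => xp; apply: noU; exists x.
  by split=> //; exact: nbhs_singleton Up.
- move=> u up; have := uP u up.
  by rewrite /within /=; apply: filterS => x Hx Ax n; exact: Hx.
- move=> [_ [V Vp]]; rewrite setIT => Ve.
  by have [x [Ax /(_ Ax)]] := iso _ Vp; rewrite Ve.
- move=> u up; have := uP u up.
  by rewrite /within /=; apply: filterS => x Hx Ax n _; exact: Hx.
Qed.

(** The fixed points of a continuous self-map of a Hausdorff space form a closed set. *)
Lemma fixed_point_cluster (Y : topologicalType) (f : Y -> Y) (x : nat -> Y) (y : Y) :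
  hausdorff_space Y -> continuous f -> (forall n, f (x n) = x n) ->
  cluster (x n @[n --> \oo]) y -> f y = y.
Proof.
move=> Yh fc fx xy; apply: Yh => V V' Vfy V'y.
have nV : nbhs y (f @^-1` V `&` V') by apply: filterI => //; exact: fc.
have [_ [[n _ <-] [Vn V'n]]] : range x `&` (f @^-1` V `&` V') !=set0.
  by apply: xy => //; exists 0%N => // n _; exists n.
by exists (x n); split => //; rewrite -fx.
Qed.

(* [r i] plays the role of the retraction of X onto the copy of X_i in X. *)
Record retraction_system (d : Order.disp_t) (I : orderType d)
    (X : topologicalType) (r : I -> X -> X) : Prop := RetractionSystem {
  rs_continuous : forall i, continuous (r i) ;
  rs_low : forall i j x, i <= j -> r i (r j x) = r i x ;
  rs_high : forall i j x, i <= j -> r j (r i x) = r i x ;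
  rs_cvg : forall x W, inhabited I -> nbhs x W ->
    exists i, forall j, i <= j -> W (r j x) ;
  rs_limit : forall k x W, limit_index k -> nbhs (r k x) W ->
    exists2 i, i < k & forall j, i <= j -> j < k -> W (r j x) }.

(** * Retractions that map neighborhoods of a P-point into the opposite side *)

Section cofinal.
Context {d : Order.disp_t} {I : orderType d} {X : topologicalType}.
Variable r : I -> X -> X.

Lemma alternating_sequence (A B : set X) (p : X) :
  retraction_system r -> closed B -> A `|` B = [set: X] -> B p ->
  (forall U, nbhs p U -> exists x, [/\ A x, U x & ~ B x]) ->
  inhabited I ->
  (forall i, exists2 j, i <= j & nbhs p [set x | B (r j x)]) ->
  exists (j : nat -> I) (x : nat -> X),
    [/\ forall n, A (x n) /\ ~ B (x n),
        forall n, r (j n.+1) (x n) = x n &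
        forall n m, (n <= m)%N -> B (r (j n) (x m))].
Proof.
move=> rs Bcl AB Bp Acl Inh cof.
(* For large [i], [r i] keeps a point of the open complement of [B] there, hence in [A], and makes
   it a fixed point of [r i]. *)
have dense U : nbhs p U -> exists x i, [/\ A x, U x, ~ B x & r i x = x].
  move=> /nbhs_interior/Acl[y [Ay Uy nBy]].
  have nW : nbhs y (U `&` ~` B).
    by apply: filterI => //; apply: open_nbhs_nbhs; split => //; exact: closed_openC.
  have [i /(_ i (lexx i))[Ui nBi]] := rs_cvg rs Inh nW.
  exists (r i y), i; split => //; last by rewrite rs_low.
  by have : (A `|` B) (r i y) by [rewrite AB]; case.
(* A state is an index, a neighborhood of [p] mapped into [B] at that index, and a point of it. The
   neighborhoods will decrease, so later points stay in earlier ones. *)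
pose inv (s : I * set X * X) := [/\ nbhs p s.1.2, s.1.2 `<=` [set z | B (r s.1.1 z)],
  s.1.2 s.2, A s.2 /\ ~ B s.2 & exists i, r i s.2 = s.2].
pose next (s t : {s | inv s}) := 
  (sval t).1.2 `<=` (sval s).1.2 /\ r (sval t).1.1 (sval s).2 = (sval s).2.
have start U i : nbhs p U -> exists s, [/\ inv s, i <= s.1.1 & s.1.2 `<=` U].
  move=> Up; have [j ij jB] := cof i.
  have [x [k [Ax [Ux Bx] nBx kx]]] := dense _ (filterI Up jB).
  exists (j, U `&` [set z | B (r j z)], x); split => //=.
  split => //=; [exact: filterI|by exists k].
have [s0 s0P] : exists s, inv s.
  by case: Inh => i; have [s [sP _ _]] := start setT i filterT; exists s.
have step s : {t | next s t}.
  case: s => -[[j U] x] sP; apply: cid.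
  have [/= Up UB Ux [Ax nBx] [i ix]] := sP.
  have [t [tP it tU]] := start U i Up.
  exists (exist _ t tP); split => //=.
  by rewrite -ix rs_high.
have [f [_ fS]] := dependent_choice step (exist _ s0 s0P).
have fU n m : (n <= m)%N -> (sval (f m)).1.2 `<=` (sval (f n)).1.2.
  elim: m => [|m IH]; first by rewrite leqn0 => /eqP ->.
  rewrite leq_eqVlt => /orP[/eqP -> //|/IH mn].
  by have [mm _] := fS m; exact: subset_trans mn.
exists (fun n => (sval (f n)).1.1), (fun n => (sval (f n)).2); split => n.
- by have [] := svalP (f n).
- by have [] := fS n.
- move=> m /fU nm; have [_ + _ _ _] := svalP (f n); apply; apply: nm.
  by have [] := svalP (f m).
Qed.

Lemma P_point_not_cofinal (A B : set X) (p : X) :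
  well_founded (fun i j : I => i < j) ->
  compact [set: X] -> hausdorff_space X -> retraction_system r ->
  closed A -> closed B -> A `|` B = [set: X] -> A `&` B = [set p] ->
  @P_point (subspace A) p -> inhabited I ->
  ~ (forall i, exists2 j, i <= j & nbhs p [set x | B (r j x)]).
Proof.
move=> wf Xc Xh rs Acl Bcl AB ABp Pp Inh cof.
have [Ap Bp] : (A `&` B) p by rewrite ABp.
move: Pp => /(subspace_P_point Ap)[Aacc Pp].
have Aacc' U : nbhs p U -> exists x, [/\ A x, U x & ~ B x].
  move=> /Aacc[x [Ax Ux xp]]; exists x; split => // Bx; apply: xp.
  by have : (A `&` B) x by []; rewrite ABp.
have [j [x [xA rx rB]]] := alternating_sequence rs Bcl AB Bp Aacc' Inh cof.
have [y [_ xy]] := Xc (x n @[n --> \oo]) _ filterT.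
have often V N : nbhs y V -> exists2 m, (N <= m)%N & V (x m).
  move=> Vy; have [_ [[m Nm <-] Vm]] : (x @` [set m | (N <= m)%N]) `&` V !=set0.
    by apply: xy => //; exists N => // m Nm; exists m.
  by exists m.
have Ay : A y.
  apply: Acl => V /(often V 0)[m _ Vm]; exists (x m); split => //.
  by have [] := xA m.
have nBy : ~ B y.
  (* If [y] were [p], the P-point property for the complements of the points [x n] would give a
     neighborhood of [p] that misses them all. *)
  move=> By; have yp : y = p by have : (A `&` B) y by []; rewrite ABp.
  have : nbhs p [set z | A z -> forall n, z <> x n].
    apply: Pp => n; suff : nbhs p (~` [set x n]) by apply: filterS => z + _.
    apply: open_nbhs_nbhs; split.
      by apply: closed_openC; apply: accessible_closed_set1; exact: hausdorff_accessible.
    by move=> /= pxn; have [_] := xA n; rewrite -pxn.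
  rewrite -yp => /(often _ 0)[m _ /(_ (proj1 (xA m)) m)]; exact.
have nBopen z : ~ B z -> nbhs z (~` B).
  by move=> nBz; apply: open_nbhs_nbhs; split => //; exact: closed_openC.
(* Either the [j n] are cofinal and some [r (j n) y] is close to [y], or they have a least upper
   bound [k]. Then [r k] fixes every [x n], hence [y], and if [k] is not attained it is a limit
   index. *)
have [n nBn] : exists n, ~ B (r (j n) y).
  have [bnd|unb] := pselect (exists k, forall n, j n <= k); last first.
    have [i iP] := rs_cvg rs Inh (nBopen _ nBy).
    have [n ijn] : exists n, i <= j n.
      apply: contrapT => noi; apply: unb; exists i => n.
      by rewrite leNgt; apply/negP => /ltW ijn; apply: noi; exists n.
    by exists n; exact: iP.
  have [k0 k0P] := bnd.
  have [k jk kmin] := well_founded_min wf (k0P : [set k | forall n, j n <= k] k0).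
  have ky : r k y = y.
    apply: (fixed_point_cluster Xh _ _ xy) => [|n]; first exact: rs_continuous.
    by rewrite -(rx n) rs_high.
  have [[n nk]|jNk] := pselect (exists n, j n = k); first by exists n; rewrite nk ky.
  have jltk n : j n < k.
    by rewrite lt_neqAle jk andbT; apply/eqP => jnk; apply: jNk; exists n.
  have above i : i < k -> exists n, i < j n.
    move=> ik; apply: contrapT => noi.
    suff : k <= i by rewrite leNgt ik.
    by apply: kmin => n; rewrite leNgt; apply/negP => ?; apply: noi; exists n.
  have limk : limit_index k.
    split; first by exists (j 0%N).
    by move=> i /above[n ijn]; exists (j n).
  have [i ik iP] := rs_limit rs limk (nBopen (r k y) (eq_ind_r (fun z => ~ B z) nBy ky)).
  by have [n /ltW ijn] := above i ik; exists n; exact: iP.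
have [m nm] := often _ n (rs_continuous rs (nBopen _ nBn)).
by apply; exact: rB.
Qed.

End cofinal.

(** * Coherent sections along a continuous sequence of retractions *)

Section retraction_sequences.
Context {d : Order.disp_t} {I : orderType d} (S : inverse_sequence I).

Definition successor_of (i j : I) : Prop := i < j /\ forall k, ~ (i < k /\ k < j).

Lemma limit_or_successor (i k : I) :
  i < k -> limit_index k \/ exists2 j, i <= j & successor_of j k.
Proof.
move=> ik; have [[j [jk jmax]]|noj] := pselect (exists j, successor_of j k).
  by right; exists j => //; rewrite leNgt; apply/negP => ji; exact: (jmax i).
left; split; first by exists i.
move=> j jk; apply: contrapT => nbtw; apply: noj; exists j; split => // l [jl lk].
by apply: nbtw; exists l.
Qed.

Lemma limit_index_cone (k : I) : continuous_sequence S -> limit_index k ->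
  limit_cone (fun (i : below k) (x : S k) => bond S (ltW (set_valP i)) x).
Proof.
move=> Sc /Sc[h [/homeomorphism_limit_cone hcone hE]].
suff -> : (fun (i : below k) (x : S k) => bond S (ltW (set_valP i)) x) =
  (fun i x => set_val (h x) i) by [].
by apply: functional_extensionality_dep => i; apply/funext => x; rewrite hE.
Qed.

Variable sg : forall i j : I, i <= j -> S i -> S j.
Hypothesis sg_continuous : forall i j (ij : i <= j), continuous (sg ij).
Hypothesis sgK : forall i j (ij : i <= j), cancel (sg ij) (bond S ij).

(* The coordinates of z above i are obtained at successors by applying [sg]; at
   limits they are then forced. So a point of S_i extends in exactly one way,
   which makes the sections below coherent. *)
Definition extends_by_sg (i k : I) (z : S k) : Prop :=
  forall j j' (jj' : j <= j') (j'k : j' <= k) (jk : j <= k),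
    i <= j -> successor_of j j' -> bond S j'k z = sg jj' (bond S jk z).

Lemma extends_by_sg_bond (i k k' : I) (kk' : k <= k') (z : S k') :
  extends_by_sg i z -> extends_by_sg i (bond S kk' z).
Proof.
move=> zP j j' jj' j'k jk ij jsj'.
by rewrite !(bond_comp _ _ (le_trans _ kk')); exact: zP.
Qed.

Lemma extends_by_sg_le (i i' k : I) (z : S k) :
  i <= i' -> extends_by_sg i z -> extends_by_sg i' z.
Proof. by move=> ii' zP j j' jj' j'k jk i'j; apply: zP; exact: le_trans i'j. Qed.

Lemma extends_by_sg_low (i k : I) (z : S k) : k <= i -> extends_by_sg i z.
Proof.
move=> ki j j' jj' j'k jk ij [jltj' _].
by have := lt_le_trans jltj' (le_trans (le_trans j'k ki) ij); rewrite ltxx.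
Qed.

(** Above [i] the uniqueness assumed at each stage applies; below [i] the bonding maps decide. This
    serves both at limit indices and for the limit of the whole sequence. *)
Lemma cone_extends_by_sg_inj (D : set I) (X : topologicalType)
    (pi : forall i : D, X -> S (set_val i)) (i : D) (x y : X) :
  limit_cone pi ->
  (forall (j : D) (ij : set_val i <= set_val j) (z z' : S (set_val j)),
    extends_by_sg (set_val i) z -> extends_by_sg (set_val i) z' ->
    bond S ij z = bond S ij z' -> z = z') ->
  (forall j, extends_by_sg (set_val i) (pi j x)) ->
  (forall j, extends_by_sg (set_val i) (pi j y)) ->
  pi i x = pi i y -> x = y.
Proof.
move=> c uniq xP yP xy; apply: (cone_inj c) => j.
have /orP[ij|ji] := le_total (set_val i) (set_val j).
  by apply: (uniq j ij) => //; rewrite !(cone_bond c).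
by rewrite -!(cone_bond c ji) xy.
Qed.

Lemma cone_extends_by_sg_section (D : set I) (X : topologicalType)
    (pi : forall i : D, X -> S (set_val i)) (i : D) :
  limit_cone pi ->
  (forall (j : D) (ij : set_val i <= set_val j) (z z' : S (set_val j)),
    extends_by_sg (set_val i) z -> extends_by_sg (set_val i) z' ->
    bond S ij z = bond S ij z' -> z = z') ->
  (forall (j : D) (ij : set_val i <= set_val j),
    exists s : S (set_val i) -> S (set_val j),
    [/\ continuous s, cancel s (bond S ij) &
        forall x, extends_by_sg (set_val i) (s x)]) ->
  exists s : S (set_val i) -> X,
    [/\ continuous s, cancel s (pi i) &
        forall x j, extends_by_sg (set_val i) (pi j (s x))].
Proof.
move=> c uniq sec.
(* The coordinates of the section: the given sections above [i], the bonding maps below. *)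
have coord (j : D) : exists t : S (set_val i) -> S (set_val j),
    [/\ continuous t, forall ij : set_val i <= set_val j, cancel t (bond S ij),
        forall (ji : set_val j <= set_val i) x, t x = bond S ji x &
        forall x, extends_by_sg (set_val i) (t x)].
  have /orP[ij|ji] := le_total (set_val i) (set_val j).
    have [t [tc tK tP]] := sec j ij; exists t; split => //.
      by move=> ij'; rewrite (bool_irrelevance ij' ij).
    by move=> ji x; rewrite -{2}(tK x) (bond_comp _ _ (lexx _)) bond_id.
  exists (bond S ji); split.
  - exact: bond_continuous.
  - by move=> ij x; rewrite (bond_comp _ _ (lexx _)) bond_id.
  - by move=> ji' x; rewrite (bool_irrelevance ji' ji).
  - by move=> x; exact: extends_by_sg_low.
have [t tP] := choice_dep coord.
(* These coordinates form a thread: above [i], both candidates extend the same point by [sg], so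
   uniqueness identifies them. *)
have /choice[s st] : forall x, exists y, forall j, pi j y = t j x.
  move=> x; apply: (cone_thread c) => j j' jj'.
  have [_ tK tlow tx] := tP j; have [_ tK' tlow' tx'] := tP j'.
  have /orP[ij|ji] := le_total (set_val i) (set_val j).
    apply: (uniq _ ij _ _ _ (tx x)); first exact: extends_by_sg_bond (tx' x).
    by rewrite tK (bond_comp _ _ (le_trans ij jj')) tK'.
  rewrite (tlow ji); have /orP[ij'|ji'] := le_total (set_val i) (set_val j').
    by rewrite -{2}(tK' ij' x) !(bond_comp _ _ jj').
  by rewrite (tlow' ji') (bond_comp _ _ ji).
exists s; split.
- apply: (cone_continuous_to c) => j; under eq_fun do rewrite st.
  by have [] := tP j.
- move=> x; rewrite st; have [_ _ /(_ (lexx _)) -> _] := tP i.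
  by rewrite bond_id.
- by move=> x j; rewrite st; have [] := tP j.
Qed.

Hypothesis wf : well_founded (fun i j : I => i < j).
Hypothesis Sc : continuous_sequence S.

Lemma extends_by_sg_inj (i k : I) (ik : i <= k) (z z' : S k) :
  extends_by_sg i z -> extends_by_sg i z' ->
  bond S ik z = bond S ik z' -> z = z'.
Proof.
elim/(well_founded_ind wf): k => k IH in ik z z' *.
move=> zP z'P zz'; have := ik; rewrite le_eqVlt => /orP[/eqP ik'|iltk].
  by subst k; move: zz'; rewrite !bond_id.
have [klim|[j ij [jk jsk]]] := limit_or_successor iltk.
  apply: (@cone_extends_by_sg_inj _ _ _ (SigSub (mem_set (iltk : below k i))) z z'
    (limit_index_cone Sc klim)) => [j|j|j|] /=.
  - by apply: IH; exact: (set_valP j).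
  - exact: extends_by_sg_bond.
  - exact: extends_by_sg_bond.
  - by rewrite (bool_irrelevance (ltW _) ik).
(* At a successor [k] of [j], both points are the images under [sg] of their [j]-coordinates, which
   agree by induction. *)
rewrite -(bond_id (lexx k) z) -(bond_id (lexx k) z').
rewrite (zP _ _ (ltW jk) _ (ltW jk)) // (z'P _ _ (ltW jk) _ (ltW jk)) //.
congr (sg _ _); apply: (IH j jk ij).
- exact: extends_by_sg_bond.
- exact: extends_by_sg_bond.
- by rewrite !(bond_comp _ _ ik).
Qed.

Lemma extends_by_sg_section (i k : I) (ik : i <= k) :
  exists s : S i -> S k,
    [/\ continuous s, cancel s (bond S ik) & forall x, extends_by_sg i (s x)].
Proof.
elim/(well_founded_ind wf): k => k IH in ik *.
have := ik; rewrite le_eqVlt => /orP[/eqP ik'|iltk].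
  subst k; exists id; split; first by move=> x; exact: cvg_id.
    by move=> x; rewrite bond_id.
  by move=> x; exact: extends_by_sg_low.
have [klim|[j ij [jk jsk]]] := limit_or_successor iltk.
  have [||s [sc sK sP]] := @cone_extends_by_sg_section _ _ _
    (SigSub (mem_set (iltk : below k i))) (limit_index_cone Sc klim).
  - by move=> j ij z z'; exact: extends_by_sg_inj.
  - by move=> j ij; apply: IH; exact: (set_valP j).
  exists s; split => // [x|x j j' jj' j'k jk ij jsj'].
    by rewrite -{2}(sK x) (bool_irrelevance (ltW _) ik).
  (* A limit index is no successor, so the condition only concerns stages below [k]. *)
  have j'ltk : j' < k.
    rewrite lt_neqAle j'k andbT; apply/eqP => j'E; subst j'.
    have [jltk btw] := jsj'; have [_ /(_ _ jltk)[l jl lk]] := klim.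
    exact: (btw l).
  have := sP x (SigSub (mem_set (j'ltk : below k j'))) j j' jj' (lexx _) jj' ij jsj'.
  by rewrite bond_id !(bond_comp _ _ jk) (bool_irrelevance (ltW _) j'k).
have [s [sc sK sP]] := IH j jk ij.
exists (sg (ltW jk) \o s); split.
- by move=> x; apply: continuous_comp; [exact: sc|exact: sg_continuous].
- by move=> x /=; rewrite -(bond_comp ij (ltW jk)) sgK sK.
move=> x a a' aa' a'k ak ia asa' /=.
have [altk abtw] := asa'.
(* Only the step from [j] to [k] is new; steps ending at or below [j] are inherited from [s]. *)
have := a'k; rewrite le_eqVlt => /orP[/eqP a'E|a'ltk].
  subst a'; have aj : a = j.
    by apply/eqP; case: ltgtP => // [aj|ja]; [case: (abtw j)|case: (jsk a)].
  subst a; rewrite bond_id (bool_irrelevance ak aa') (bool_irrelevance (ltW jk) aa').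
  by rewrite sgK.
have a'j : a' <= j by rewrite leNgt; apply/negP => ja'; exact: (jsk a').
rewrite -(bond_comp a'j (ltW jk)) -(bond_comp (le_trans aa' a'j) (ltW jk)) sgK.
exact: sP.
Qed.

Lemma cone_retraction_system (X : topologicalType)
    (pi : forall i : [set: I], X -> S (set_val i)) :
  limit_cone pi ->
  exists (p : forall i, X -> S i) (s : forall i, S i -> X),
    [/\ forall i, continuous (p i), forall i, continuous (s i),
        forall i, cancel (s i) (p i) & retraction_system (fun i => s i \o p i)].
Proof.
move=> c; pose full i : [set: I] := SigSub (mem_set (Logic.I : [set: I] i)).
pose p i : X -> S i := pi (full i).
have pbond i j (ij : i <= j) x : bond S ij (p j x) = p i x.
  exact: (cone_bond c (i := full i) (j := full j)).
have piE (j : [set: I]) : pi j = p (set_val j).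
  by case: j => j jT; rewrite /p /full /= (bool_irrelevance jT (mem_set (Logic.I : [set: I] j))).
have /choice_dep[s sP] (i : I) : exists s : S i -> X,
    [/\ continuous s, cancel s (p i) & forall x j, extends_by_sg i (p j (s x))].
  have [||s [sc sK sP]] := cone_extends_by_sg_section
    (i := full i) c.
  - by move=> j ij z z'; exact: extends_by_sg_inj.
  - by move=> j ij; exact: extends_by_sg_section.
  by exists s; split => // x j; exact: (sP x (full j)).
pose r i := s i \o p i.
have pr i x : p i (r i x) = p i x by have [_ sK _] := sP i; rewrite /r /= sK.
(* [x] and [r i x] have the same [i]-coordinate and are both extended by [sg] from [i], so they
   coincide. *)
have rE i x : (forall j, extends_by_sg i (p j x)) -> r i x = x.
  move=> xP; apply: (cone_extends_by_sg_inj (i := full i) c).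
  - by move=> j ij z z'; exact: extends_by_sg_inj.
  - by move=> j; rewrite piE; have [_ _] := sP i; apply.
  - by move=> j; rewrite piE.
  - by rewrite !piE pr.
have r_low i j x : i <= j -> r i (r j x) = r i x.
  by move=> ij; rewrite {1 3}/r /= -!(pbond _ _ ij) pr.
have r_high i j x : i <= j -> r j (r i x) = r i x.
  move=> ij; apply: rE => l; apply: extends_by_sg_le ij _.
  by have [_ _] := sP i; apply.
have p_continuous i : continuous (p i) := cone_continuous c (full i).
have s_continuous i : continuous (s i) by have [] := sP i.
exists p, s; split => //; first by move=> i; have [] := sP i.
split => //.
- by move=> i x; apply: continuous_comp; [exact: p_continuous|exact: s_continuous].
(* For [i <= j], [r j x] lies in the [i]-fibre of [x], and some fibre is contained in [W]. *)
- move=> x W [i0] xW; have [|i iW] := cone_nbhs c _ xW; first by exists i0.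
  exists (set_val i) => j ij; apply: iW.
  by rewrite !piE -!(pbond _ _ ij) pr.
(* The same argument inside [S k], the limit of the earlier stages; it reaches [X] because [r k]
   fixes [r j x]. *)
- move=> k x W klim xW.
  have kW : nbhs (p k x) (s k @^-1` W) by exact: s_continuous.
  have [|i iW] := cone_nbhs (limit_index_cone Sc klim) _ kW.
    by have [[i0 i0k] _] := klim; exists i0.
  exists (set_val i); first exact: (set_valP i).
  move=> j ij jk; rewrite -[_ x]/(r j x) -(r_high _ _ _ (ltW jk)).
  apply: (iW (p k (r j x))).
  by rewrite !pbond -!(pbond _ _ ij) pr.
Qed.

End retraction_sequences.

(** * The metrizable case, passage to a retract, and induction on the class *)

Lemma injective_hausdorff (X Y : topologicalType) (f : X -> Y) :
  continuous f -> injective f -> hausdorff_space Y -> hausdorff_space X.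
Proof.
move=> fc finj Yh x y xy; apply/finj/Yh => V V' Vx V'y.
by have [z [Vz V'z]] := xy _ _ (fc _ _ Vx) (fc _ _ V'y); exists (f z).
Qed.

Lemma metrizable_hausdorff (R : realType) (X : topologicalType) :
  metrizable R X -> hausdorff_space X.
Proof.
move=> [M [f [fc [g [_ fK _]]]]].
by apply: (injective_hausdorff fc (can_inj fK)); exact: metric_hausdorff.
Qed.

(** The balls of radius [1/(n+1)] about a point meet in that point alone, so a P-point of [A] would
    be isolated in [A]. *)
Lemma metrizable_not_P_point (R : realType) (X : topologicalType) (A : set X) (p : X) :
  metrizable R X -> A p -> ~ @P_point (subspace A) p.
Proof.
move=> [M [f [fc [g [_ fK _]]]]] Ap /(subspace_P_point Ap)[Aacc Pp].
have /Aacc[x [Ax fx xp]] : nbhs p [set x | A x -> forall n, ball (f p) n.+1%:R^-1%R (f x)].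
  apply: Pp => n; have : nbhs p (f @^-1` ball (f p) n.+1%:R^-1%R).
    by apply: fc; apply: nbhsx_ballx; rewrite invr_gt0.
  by apply: filterS => z + _.
have e0 : (0 < mdist (f p) (f x))%R.
  by rewrite mdist_gt0; apply/eqP => /(can_inj fK) /esym.
have [n _ /(_ _ (leqnn n)) /= nlt] := near_infty_natSinv_lt (PosNum e0).
by have := fx Ax n; rewrite ballEmdist /= => /lt_trans/(_ nlt); rewrite ltxx.
Qed.

Lemma P_point_retract (X Y : topologicalType) (f : X -> Y) (g : Y -> X)
    (A B : set X) (p : X) :
  continuous f -> continuous g -> cancel g f -> A `|` B = [set: X] ->
  A p -> B p -> g (f p) = p ->
  @P_point (subspace A) p -> ~ nbhs p [set x | B (g (f x))] ->
  @P_point (subspace (g @^-1` A)) (f p).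
Proof.
move=> fc gc gK AB Ap Bp gfp /(subspace_P_point Ap)[_ Pp] nB.
have Afp : (g @^-1` A) (f p) by rewrite /= gfp.
apply/(subspace_P_point Afp).
split=> [U Up|u up].
  (* Near [p], a point [g (f x)] outside [B] lies in [A], so [f x] would be the missing point of
     [U]; it differs from [f p] because [p] is in [B]. *)
  apply: contrapT => noy; apply: nB.
  have : nbhs p (f @^-1` U) by exact: fc.
  apply: filterS => x /= Ux; apply: contrapT => nBx; apply: noy.
  exists (f x); split => //=; first by have : (A `|` B) (g (f x)) by [rewrite AB]; case.
  by move=> fxp; apply: nBx; rewrite fxp gfp.
(* The sets [u n] are pulled back along [f], intersected near [p] within [A], and the result is
   restricted along [g]. *)
have : nbhs (f p) (g @^-1` [set x | A x -> forall n, A (g (f x)) -> u n (f x)]).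
  apply: gc; rewrite gfp; apply: Pp => n.
  have : nbhs p (f @^-1` [set y | (g @^-1` A) y -> u n y]) by exact: fc.
  by apply: filterS => x /= + _.
by apply: filterS => y /= uy Ay n; have := uy Ay n; rewrite gK; apply.
Qed.

Lemma cone_not_cutting_P_point (d : Order.disp_t) (I : orderType d)
    (S : inverse_sequence I) (X : topologicalType)
    (pi : forall i : [set: I], X -> S (set_val i)) :
  well_founded (fun i j : I => i < j) -> continuous_sequence S ->
  (forall (i j : I) (ij : i <= j), retraction (bond S ij)) ->
  limit_cone pi -> compact [set: X] -> hausdorff_space X ->
  (forall i, ~ exists q : S i, cutting_P_point q) ->
  ~ exists p : X, cutting_P_point p.
Proof.
move=> wf Sc ret c Xc Xh noq [p [A [B [[Acl Bcl AB ABp] [PA PB]]]]].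
have [Ap Bp] : (A `&` B) p by rewrite ABp.
have /choice_dep[sg sgP] (i : I) :=
  choice_dep (fun j => choice_dep (fun ij => proj2 (ret i j ij))).
have [f [g [fc gc gK rs]]] := cone_retraction_system
  (fun i j ij => proj1 (sgP i j ij)) (fun i j ij => proj2 (sgP i j ij)) wf Sc c.
(* Without indices the limit has at most one point, but [p] is not isolated in [A]. *)
have Inh : inhabited I.
  apply: contrapT => noI; move: PA => /(subspace_P_point Ap)[/(_ _ filterT)[x [_ _ xp]] _].
  by apply: xp; apply: (cone_inj c) => i; case: noI; exists; exact: (set_val i).
have BA : B `|` A = [set: X] by rewrite setUC.
have BAp : B `&` A = [set p] by rewrite setIC.
have bound (C : set X) :
    ~ (forall i, exists2 j, i <= j & nbhs p [set x | C (g j (f j x))]) ->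
    exists i, forall j, i <= j -> ~ nbhs p [set x | C (g j (f j x))].
  move=> nC; apply: contrapT => noi; apply: nC => i; apply: contrapT => noj.
  by apply: noi; exists i => j ij Cj; apply: noj; exists j.
have [iB nB] := bound B (P_point_not_cofinal wf Xc Xh rs Acl Bcl AB ABp PA Inh).
have [iA nA] := bound A (P_point_not_cofinal wf Xc Xh rs Bcl Acl BA BAp PB Inh).
pose i := Order.max iA iB.
have {}nA : ~ nbhs p [set x | A (g i (f i x))] by apply: nA; rewrite le_max lexx.
have {}nB : ~ nbhs p [set x | B (g i (f i x))].
  by apply: nB; rewrite le_max lexx orbT.
have rc : continuous (g i \o f i) := rs_continuous rs (i := i).
(* If the image of [p] were outside the closed set [C], a whole neighborhood of [p] would be mapped
   into [D]. Used for both sides, this puts the image in [A] and in [B]. *)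
have side (C D : set X) : closed C -> C `|` D = [set: X] ->
    ~ nbhs p [set x | D (g i (f i x))] -> C (g i (f i p)).
  move=> Ccl CD nD; apply: contrapT => nC; apply: nD.
  have : nbhs p ((g i \o f i) @^-1` ~` C).
    by apply: rc; apply: open_nbhs_nbhs; split => //; exact: closed_openC.
  apply: filterS => x /= nCx.
  by have : (C `|` D) (g i (f i x)) by [rewrite CD]; case.
have rp : g i (f i p) = p.
  have : (A `&` B) (g i (f i p)) by split; [exact: (side A B)|exact: (side B A)].
  by rewrite ABp.
apply: (noq i); exists (f i p), (g i @^-1` A), (g i @^-1` B); split.
  split.
  - by apply: closed_comp => // x _; exact: gc.
  - by apply: closed_comp => // x _; exact: gc.
  - by rewrite -preimage_setU AB preimage_setT.
  - apply/seteqP; split=> [x ABx|x -> /=]; last by rewrite rp.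
    have : (A `&` B) (g i x) by [].
    by rewrite ABp /= => gx; rewrite -gx gK.
split; first exact: (P_point_retract _ _ _ AB).
exact: (P_point_retract _ _ _ BA).
Qed.

(** Compactness and the Hausdorff property are carried through the induction: the limit step uses
    both on the limit and obtains them from the stages. *)
Lemma classR_compact_hausdorff_no_cutting (R : realType) (X : topologicalType) :
  classR R X ->
  [/\ compact [set: X], hausdorff_space X & ~ exists p : X, cutting_P_point p].
Proof.
elim=> {X} [X Xc Xm|d I S X wf _ IH Sc ret [h /homeomorphism_limit_cone c]].
  split => //; first exact: metrizable_hausdorff Xm.
  move=> [p [A [B [[_ _ _ ABp] [PA _]]]]]; apply: metrizable_not_P_point Xm _ PA.
  by have [] : (A `&` B) p by rewrite ABp.
have Sh i : hausdorff_space (S i) by have [] := IH i.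
have Scpt i : compact [set: S i] by have [] := IH i.
have Xc := cone_compact c Sh Scpt; have Xh := cone_hausdorff c Sh.
split => //; apply: (cone_not_cutting_P_point wf Sc ret c Xc Xh) => i.
by have [] := IH i.
Qed.

Theorem theorem4p5 (R : realType) (X : topologicalType) (hX : classR R X) :
  ~ (exists p : X, cutting_P_point p).
Proof. by have [] := classR_compact_hausdorff_no_cutting hX. Qed.
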